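(* Let $\mathbb{F}_q$ be a finite field of characteristic $3$ and let $\mathcal{F}=\mathbb{F}_q(x,y)$ be a cubic function field given in standard form by $y^3-Ay+B=0$ with $A,B\in\mathbb{F}_q[x]$. Assume that $A\neq 0$ is cubefree and that every finite place $P$ of $\mathbb{F}_q(x)$ with $3v_P(A)>2v_P(B)$ has $P$-signature $(3,1)$. Set $I=\mathrm{ind}(y)$ and $G=\gcd(I,B)$. Let $U,V,W\in\mathbb{F}_q[x]$ satisfy $$U^3+B\equiv 0 \pmod{(I/G)^2},\qquad U\equiv 0\pmod G,\qquad V\equiv U^2\pmod I.$$ Then $\{1,\;y+W,\;(y^2+Uy+V)/I\}$ is an integral basis of $\mathcal{F}/\mathbb{F}_q(x)$.
   Context: Cubic function field in standard form: $\mathcal{F}=\mathbb{F}_q(x,y)$ where $x$ is transcendental over $\mathbb{F}_q$, $T^3-A(x)T+B(x)\in\mathbb{F}_q[x][T]$ is irreducible over $\mathbb{F}_q(x)$ with root $y$, at least one of $A,B$ is non-constant, there is no non-constant $Q\in\mathbb{F}_q[x]$ with $Q^2\mid A$ and $Q^3\mid B$, and $\mathbb{F}_q$ is algebraically closed in $\mathcal{F}$. Finite places of $\mathbb{F}_q(x)$ are identified with monic irreducible polynomials $P\in\mathbb{F}_q[x]$, with valuation $v_P$. $P$-signature $(3,1)$ means that there is exactly one place of $\mathcal{F}$ above $P$, with ramification index $3$ and relative degree $1$. $\mathcal{O}$ is the integral closure of $\mathbb{F}_q[x]$ in $\mathcal{F}$; an integral basis of $\mathcal{F}/\mathbb{F}_q(x)$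 is an $\mathbb{F}_q[x]$-basis of $\mathcal{O}$. $\Delta=\mathrm{disc}(\mathcal{F})$ is the discriminant of an integral basis (well defined up to squares in $\mathbb{F}_q^*$), $D=\mathrm{disc}(1,y,y^2)=4A^3-27B^2=A^3$, and the index $I=\mathrm{ind}(y)\in\mathbb{F}_q[x]$ is defined, up to a constant factor, by $D=I^2\Delta$. *)

(* Defs.v *)
From HB Require Import structures.
From mathcomp Require Import all_boot all_order all_algebra all_field.

Set Implicit Arguments.
Unset Strict Implicit.
Unset Printing Implicit Defensive.

Import GRing.Theory.
Local Open Scope ring_scope.

Section FunctionField.

(* [{fraction {poly F}}] is the rational function field F(x), with x = ['X]; *)
(* [L] is a finite extension of it.                                          *)
Variables (F : finFieldType) (L : fieldExtType {fraction {poly F}}).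
Implicit Types (z : L) (A B I P Q : {poly F}) (O : {pred L}).

Definition poly_in (p : {poly F}) : L := in_alg L (FracField.tofrac p).

Definition const_in (c : F) : L := poly_in c%:P.

Definition cubic_poly A B : {poly {fraction {poly F}}} :=
  'X^3 - (FracField.tofrac A) *: 'X + (FracField.tofrac B)%:P.

Record cubic_standard_form A B (y : L) : Prop := {
  csf_irreducible : irreducible_poly (cubic_poly A B);
  csf_root : root (map_poly (in_alg L) (cubic_poly A B)) y;
  csf_generated : <<1; y>>%VS = {:L}%VS;
  csf_nonconstant : (1 < size A)%N || (1 < size B)%N;
  csf_reduced : forall Q, Q ^+ 2 %| A -> Q ^+ 3 %| B -> (size Q <= 1)%N;
  csf_constants : forall z, algebraicOver const_in z -> exists c, z = const_in c
}.

Definition cubefree A : Prop := forall Q, Q ^+ 3 %| A -> (size Q <= 1)%N.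

(* Meaningful for nonconstant P and nonzero A only: then P ^+ n %| A forces  *)
(* n < size A.  (The value at A = 0 is 0 instead of infinity.)               *)
Definition poly_val P A : nat := \max_(n < size A | P ^+ n %| A) n.

(* Places of L are represented by their valuation rings.                     *)
Definition valuation_ring O : Prop :=
  [/\ subring_closed O,
      forall c, const_in c \in O,
      exists z, z \notin O
    & forall z, z != 0 -> (z \in O) || (z^-1 \in O)].

Definition max_ideal O : {pred L} :=
  [pred z | (z \in O) && ((z == 0) || (z^-1 \notin O))].

(* O meets F(x) in the localization of F[x] at the prime P.                  *)
Definition lies_above O P : Prop :=
  forall r : {fraction {poly F}}, in_alg L r \in O <->
    exists a b : {poly F},
      ~~ (P %| b) /\ r = FracField.tofrac a / FracField.tofrac b.

(* t is a uniformizer, and P is a unit of O times t ^+ e.                    *)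
Definition ramification_index O P (e : nat) : Prop :=
  exists t u : L,
    [/\ forall z, z \in max_ideal O <-> exists2 w, w \in O & z = t * w,
        u \in O, u^-1 \in O & poly_in P = u * t ^+ e].

(* The residue classes of s_0, ..., s_(f-1) form a basis of the residue      *)
(* field of O over F[x]/(P).                                                 *)
Definition relative_degree O P (f : nat) : Prop :=
  exists s : f.-tuple L,
    [/\ forall i, tnth s i \in O,
        forall z, z \in O -> exists c : 'I_f -> {poly F},
          z - \sum_i poly_in (c i) * tnth s i \in max_ideal O
      & forall c : 'I_f -> {poly F},
          \sum_i poly_in (c i) * tnth s i \in max_ideal O ->
          forall i, P %| c i].

(* Signature (e, f): a single place above P, with the given invariants.      *)
Definition signature1 P (e f : nat) : Prop :=
  exists O,
    [/\ valuation_ring O, lies_above O P,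
        forall O', valuation_ring O' -> lies_above O' P -> O' =i O,
        ramification_index O P e & relative_degree O P f].

Definition integral_basis n (b : n.-tuple L) : Prop :=
  (forall i, integralOver poly_in (tnth b i)) /\
  (forall z, integralOver poly_in z ->
     exists! c : {ffun 'I_n -> {poly F}}, z = \sum_i poly_in (c i) * tnth b i).

Definition field_trace z : {fraction {poly F}} :=
  \tr (passmx.mxof (vbasis {:L}) (vbasis {:L}) (amull z)).

Definition disc n (b : n.-tuple L) : {fraction {poly F}} :=
  \det (\matrix_(i < n, j < n) field_trace (tnth b i * tnth b j)).

(* I = ind(y), which is only defined up to a nonzero constant factor.        *)
Definition is_index (y : L) I : Prop :=
  exists b : 3.-tuple L, integral_basis b /\
    disc [tuple 1; y; y ^+ 2] = FracField.tofrac I ^+ 2 * disc b.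

End FunctionField.

(* Main.v *)
Require Import Defs.
From HB Require Import structures.
From mathcomp Require Import all_boot all_order all_algebra all_field.
From mathcomp Require Import ring.

Set Implicit Arguments.
Unset Strict Implicit.
Unset Printing Implicit Defensive.

Import GRing.Theory.
Local Open Scope ring_scope.

(** In characteristic 3 one has [y^2 + U y + V = (y - U)^2 + (V - U^2)], so up
    to a polynomial the third element is [w = (y - U)^2 / I].  Since
    [t = y - U] satisfies [t^3 = A t - C] with [C = U^3 + B - A U], squaring
    gives
      [w^3 + (A / I) w^2 + (A / I)^2 w - C^2 / I^3 = 0],
    and [w] is integral as soon as [I] divides [A] and [I^3] divides [C^2]
    ([square_quotient_integral]).  The three elements come from [1, y, y^2] by
    a triangular change of basis of determinant [1 / I], hence they have the
    discriminant of an integral basis; being integral, they form one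
    ([integral_basis_same_disc]).

    There remains to see that [I] is squarefree, divides [A], and that [I^2]
    divides [C].  This is checked at one prime [P] dividing [I] at a time
    ([index_local]), writing [A^3 = I^2 d] where [d] is the discriminant of an
    integral basis.  Two facts about a totally ramified place above [P] are
    used.

    - Ramification of index 3 is wild here: the trace of every integral
      element is divisible by [P].  The Gram matrix defining [d] is thus a
      multiple of [P], and [P^3] divides [d] ([wild_disc]).  With [A] cubefree
      this forces [v_P(I) <= 1], and [v_P(I) = 0] when [v_P(A) = 1].
    - If [v_P(B) = 1] then [y] itself is a uniformizer
      ([eisenstein_uniformizer]); the powers of a uniformizer generate the
      integers locally, so that [P] does not divide [I]
      ([uniformizer_index]).

    Both follow from the same description of a totally ramified extension of
    degree [n] with uniformizer [t]: an element [sum_k c_k t^k] lies in the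
    valuation ring exactly when all the [c_k] do, because the valuations of
    its nonzero terms are distinct modulo [n] ([ram_coef_low], [ram_coef_O]). *)

(** * Traces and discriminants *)

(** The trace is the one of the matrix in a chosen basis; this computes it in
    any other basis, whose length need not be syntactically [\dim {:V}]. *)
Lemma mxtrace_lfun_basis (K : fieldType) (V : vectType K) (f : 'End(V)) n
    (X : n.-tuple V) : basis_of {:V} X ->
  \tr (passmx.mxof (vbasis {:V}) (vbasis {:V}) f) = \sum_i coord X i (f X`_i).
Proof.
move=> Xbasis.
pose v := vbasis {:V}.
have vbas : basis_of {:V} v := vbasisP _.
pose M := \matrix_(i < n, j < \dim {:V}) coord v j X`_i.
pose N := \matrix_(j < \dim {:V}, i < n) coord X i v`_j.
pose C := \matrix_(i < n, j < n) coord X j (f X`_i).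
have MN : M *m N = 1%:M.
  apply/matrixP => i k; rewrite !mxE.
  rewrite -(coord_free i k (basis_free Xbasis)) //.
  rewrite [u in _ = coord _ _ u](coord_basis vbas (memvf _)) linear_sum /=.
  by apply: eq_bigr => j _; rewrite !mxE linearZ.
suff -> : passmx.mxof v v f = N *m C *m M.
  rewrite mxtrace_mulC mulmxA MN mul1mx /mxtrace.
  by apply: eq_bigr => i _; rewrite mxE.
apply/matrixP => i j; rewrite !mxE /=.
rewrite passmx.vecof_delta.
rewrite [u in f u](coord_basis Xbasis (memvf _)) linear_sum linear_sum /=.
under [RHS]eq_bigr do rewrite !mxE mulr_suml.
rewrite exchange_big /=; apply: eq_bigr => k _.
rewrite linearZ linearZ /=.
have -> : coord v j (f X`_k) = coord v j (\sum_l coord X l (f X`_k) *: X`_l).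
  by rewrite -(coord_basis Xbasis (memvf _)).
rewrite linear_sum mulr_sumr; apply: eq_bigr => l _.
by rewrite linearZ /= !mxE mulrA.
Qed.

Section Discriminant.
Variables (F : finFieldType) (L : fieldExtType {fraction {poly F}}).

Fact field_trace_is_linear : linear_for *%R (@field_trace F L).
Proof.
move=> a u v; rewrite /field_trace linearP passmx.mxof_linear.
by rewrite mxtraceD mxtraceZ.
Qed.
HB.instance Definition _ := GRing.isSemilinear.Build _ _ _ _ (@field_trace F L)
   (GRing.semilinear_linear field_trace_is_linear).

Lemma disc_change n (M : 'M_n) (b e : n.-tuple L) :
  (forall i, tnth e i = \sum_j M i j *: tnth b j) ->
  disc e = \det M ^+ 2 * disc b.
Proof.
move=> eE.
rewrite /disc; set G := (G in _ = _ * \det G).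
have -> : \det M ^+ 2 * \det G = \det (M *m G *m M^T).
  by rewrite !det_mulmx det_tr expr2 mulrAC.
congr (\det _).
apply/matrixP => i j; rewrite !mxE !eE mulr_suml.
rewrite linear_sum /=.
under [RHS]eq_bigr do rewrite !mxE mulr_suml.
rewrite [RHS]exchange_big /=; apply: eq_bigr => k _.
rewrite mulr_sumr linear_sum /=; apply: eq_bigr => l _.
rewrite mxE -scalerAl -scalerAr !linearZ /=.
by rewrite mulrAC mulrA.
Qed.
End Discriminant.

(** * Valuation rings *)

Section ValuationSubring.
Variables (L : fieldType) (O : {pred L}).
Hypothesis Oring : subring_closed O.
HB.instance Definition _ := GRing.isSubringClosed.Build L O Oring.
Hypothesis Oval : forall z, z != 0 -> (z \in O) || (z^-1 \in O).

(** Valuation rings are integrally closed: otherwise [z^-1] is in [O], and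
    dividing the equation of [z] by [z ^+ (deg p - 1)] expresses [z] as a
    polynomial in [z^-1]. *)
Lemma valuation_ring_integral (p : {poly L}) z :
  p \is monic -> root p z -> p \is a polyOver O -> z \in O.
Proof.
move=> pmon pz0 pO; have [-> | z_neq0] := eqVneq z 0; first exact: rpred0.
case: (boolP (z \in O)) => // zO; have := Oval z_neq0; rewrite (negPf zO) /=.
move=> wO; case/negP: zO.
have sp : (1 < size p)%N.
  by apply: root_size_gt1 pz0; apply: monic_neq0.
have := rootP pz0; rewrite horner_coef; move: (sp).
case En: (size p) => [|[|n]] //= _.
have lc : p`_n.+1 = 1 by have := monicP pmon; rewrite lead_coefE En.
rewrite big_ord_recr /= lc mul1r exprS => /eqP; rewrite addrC addr_eq0 => /eqP zE.
have zn : z ^+ n != 0 by rewrite expf_neq0.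
have -> : z = - \sum_(i < n.+1) p`_i * z^-1 ^+ (n - i).
  apply: (mulIf zn); rewrite zE mulNr mulr_suml; congr (- _).
  apply: eq_bigr => i _; rewrite -mulrA; congr (_ * _).
  have -> : z ^+ n = z ^+ (n - i) * z ^+ i by rewrite -exprD subnK // -ltnS.
  by rewrite exprVn mulKf // expf_neq0.
rewrite rpredN rpred_sum // => i _.
by rewrite rpredM ?rpredX // (polyOverP pO).
Qed.
End ValuationSubring.

(** * Totally ramified extensions *)

(** [O] is a valuation ring of [L] with uniformizer [t], so that [z / t ^+ j]
    is in [O] when [z] has valuation at least [j].  [Oram] says that the
    ramification index over [K] is at least [n]: an element of [K] with
    positive valuation has valuation at least [n]. *)

Section TotallyRamified.
Variables (K : fieldType) (L : fieldExtType K) (O : {pred L}) (t : L) (n : nat).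
Hypothesis Oring : subring_closed O.
HB.instance Definition _ := GRing.isSubringClosed.Build L O Oring.
Hypothesis Oval : forall z, z != 0 -> (z \in O) || (z^-1 \in O).
Hypotheses (t_neq0 : t != 0) (tO : t \in O) (tVO : t^-1 \notin O).
Hypothesis Omax : forall z, z \in O -> (z == 0) || (z^-1 \notin O) -> z / t \in O.
Hypothesis Oram : forall r : K, r%:A / t \in O -> r%:A / t ^+ n \in O.

Let expB i j : (i <= j)%N -> t ^+ (j - i) = t ^+ j / t ^+ i.
Proof. by move=> ij; rewrite expfB_cond // (negPf t_neq0). Qed.

Let in_divX i j z : (i <= j)%N -> z / t ^+ j \in O -> z / t ^+ i \in O.
Proof.
move=> ij zj; have -> : z / t ^+ i = z / t ^+ j * t ^+ (j - i).
  by rewrite -mulrA expB // mulKf // expf_neq0.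
by rewrite rpredM ?rpredX.
Qed.

(** By induction on [j]: once [c_0, ..., c_(j-1)] have positive valuation they
    have valuation at least [n >= j + 1], so modulo [t ^+ j.+1] the sum
    reduces to [c_j t ^+ j]. *)
Lemma ram_coef_low (c : 'I_n -> K) j : (forall k, (c k)%:A \in O) -> (j <= n)%N ->
  (\sum_k c k *: t ^+ k) / t ^+ j \in O ->
  forall k : 'I_n, (k < j)%N -> (c k)%:A / t \in O.
Proof.
move=> cO; elim: j => // j IHj jn zO k.
have IH := IHj (ltnW jn) (in_divX (leqnSn j) zO).
rewrite ltnS leq_eqVlt => /predU1P[kj | /IH //].
move: zO; rewrite (bigD1 k) //= mulrDl => zO.
suff cO' : (\sum_(i < n | i != k) c i *: t ^+ i) / t ^+ j.+1 \in O.
  move: zO; rewrite rpredDr // -(mulr_algl (c k) (t ^+ k)) kj exprSr invfM.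
  by rewrite -mulrA mulVKf // expf_neq0.
rewrite mulr_suml rpred_sum // => i ik; rewrite -mulr_algl.
have : (i : nat) != j by rewrite -kj.
rewrite neq_ltn => /orP[lt | gt].
  have h : (c i)%:A / t ^+ n \in O by apply/Oram/IH.
  have -> : (c i)%:A * t ^+ i / t ^+ j.+1 =
      (c i)%:A / t ^+ n * t ^+ (n - j.+1) * t ^+ i.
    rewrite mulrAC; congr (_ * _).
    by rewrite -mulrA expB // mulKf // expf_neq0.
  by rewrite rpredM ?rpredX // rpredM ?rpredX.
by rewrite -mulrA -expB // rpredM ?rpredX.
Qed.

(** The element [i] has minimal valuation among the [c k]. *)
Lemma exists_dominant (c : 'I_n -> K) : (exists k, c k != 0) ->
  exists i, c i != 0 /\ forall k, (c k / c i)%:A \in O.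
Proof.
suff dom (s : seq 'I_n) : has (fun k => c k != 0) s ->
    exists i, c i != 0 /\ forall k, k \in s -> (c k / c i)%:A \in O.
  case=> k ck; have [|i [ci cO]] := dom (enum 'I_n).
    by apply/hasP; exists k; rewrite ?mem_enum.
  by exists i; split=> // l; apply: cO; rewrite mem_enum.
elim: s => //= k s IHs.
have [ck0 /= /IHs[i [ci cO]] | ck _] := eqVneq (c k) 0.
  exists i; split=> // l; rewrite inE => /predU1P[-> | /cO //].
  by rewrite ck0 mul0r scale0r rpred0.
have [/IHs[i [ci cO]] | /hasPn s0] := boolP (has (fun k => c k != 0) s); last first.
  exists k; split=> // l; rewrite inE => /predU1P[-> | /s0 /negPn/eqP ->].
    by rewrite divff // scale1r rpred1.
  by rewrite mul0r scale0r rpred0.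
have : (c k / c i)%:A != 0 :> L by rewrite scaler_eq0 oner_eq0 orbF mulf_neq0 ?invr_eq0.
move/Oval/orP=> [kiO | ikO].
  by exists i; split=> // l; rewrite inE => /predU1P[-> | /cO].
exists k; split=> // l; rewrite inE => /predU1P[-> | /cO liO].
  by rewrite divff // scale1r rpred1.
have -> : (c l / c k)%:A = (c l / c i)%:A * ((c k / c i)%:A)^-1 :> L.
  have inA (r : K) : r%:A = in_alg L r by [].
  rewrite !inA -fmorph_div; congr (in_alg L _).
  by rewrite invfM invrK mulrCA divfK // mulrC.
by rewrite rpredM.
Qed.

(** Divide by a coefficient [c i] of minimal valuation.  If it were not in [O],
    the quotient would have valuation at least [n], and [ram_coef_low] would
    make the coefficient [1] a non-unit. *)
Lemma ram_coef_O (c : 'I_n -> K) :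
  \sum_k c k *: t ^+ k \in O -> forall k, (c k)%:A \in O.
Proof.
have inA (r : K) : r%:A = in_alg L r by [].
move=> zO; have [/existsP/exists_dominant[i [ci cO]] k | ] := boolP [exists k, c k != 0].
  suff ciO : (c i)%:A \in O.
    by rewrite -(divfK ci (c k)) inA rmorphM rpredM //; apply: cO.
  apply/negPn/negP => ciO.
  have ciL : (c i)%:A != 0 :> L by rewrite scaler_eq0 oner_eq0 orbF.
  have ciVO : (c i)^-1%:A \in O.
    by have := Oval ciL; rewrite (negPf ciO) /= [in X in _ -> X]inA fmorphV.
  have := Omax ciVO; rewrite inA fmorphV invrK ciO orbT -fmorphV => /(_ isT)/Oram h.
  have := @ram_coef_low (fun k => c k / c i) n cO (leqnn n) _ i (ltn_ord i).
  rewrite divff // scale1r mul1r; move=> tV; case/negP: tVO; apply: tV.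
  under eq_bigr do rewrite mulrC -scalerA.
  by rewrite -scaler_sumr -mulr_algl mulrAC mulrC rpredM.
rewrite negb_exists => /forallP c0 k.
by move: (c0 k); rewrite negbK => /eqP ->; rewrite scale0r rpred0.
Qed.

Lemma ram_free (c : 'I_n -> K) : \sum_k c k *: t ^+ k = 0 -> forall k, c k = 0.
Proof.
move=> c0 k; apply/eqP/negPn/negP => ck.
have [i [ci cO]] : exists i, c i != 0 /\ forall k, (c k / c i)%:A \in O.
  by apply: exists_dominant; exists k.
have := @ram_coef_low (fun k => c k / c i) n cO (leqnn n) _ i (ltn_ord i).
rewrite divff // scale1r mul1r; move=> tV; case/negP: tVO; apply: tV.
under eq_bigr do rewrite mulrC -scalerA.
by rewrite -scaler_sumr c0 scaler0 mul0r rpred0.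
Qed.

Definition powers := [tuple t ^+ i | i < n].

Lemma powersE (i : 'I_n) : powers`_i = t ^+ i.
Proof. by rewrite -tnth_nth tnth_mktuple. Qed.

Hypothesis dimL : \dim {:L} = n.

Lemma powers_basis : basis_of {:L} powers.
Proof.
rewrite basisEfree subvf size_tuple dimL leqnn !andbT.
apply/freeP => c c0; apply: ram_free.
by rewrite -[RHS]c0; apply: eq_bigr => i _; rewrite powersE.
Qed.

Lemma powers_coord z : z = \sum_i coord powers i z *: t ^+ i.
Proof.
rewrite {1}(coord_basis powers_basis (memvf z)).
by apply: eq_bigr => i _; rewrite powersE.
Qed.

Lemma powers_coord_O z i : z \in O -> (coord powers i z)%:A \in O.
Proof.
by move=> zO; apply: (@ram_coef_O (fun i => coord powers i z)); rewrite -powers_coord.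
Qed.

(** Let [a] be the constant coordinate of [z].  Multiplication by [z - a]
    raises the valuation, so its matrix in the basis of powers of [t] is
    strictly triangular modulo the maximal ideal.  The trace of [a] is [n a = 0]: this is where ramification
    has to be wild. *)
Lemma tot_ram_trace z : n%:R = 0 :> K -> z \in O ->
  (\tr (passmx.mxof (vbasis {:L}) (vbasis {:L}) (amull z)))%:A / t \in O.
Proof.
move=> n0 zO; rewrite (mxtrace_lfun_basis _ powers_basis).
have [n_eq0 | n_gt0] := posnP n.
  rewrite big1 ?scale0r ?mul0r ?rpred0 // => i.
  by have := ltn_ord i; rewrite {2}n_eq0.
pose a := coord powers (Ordinal n_gt0) z.
have az : (z - a%:A) / t \in O.
  rewrite {1}(powers_coord z) (bigD1 (Ordinal n_gt0)) //= expr0.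
  rewrite [_ + _ - _]addrAC subrr add0r.
  rewrite mulr_suml rpred_sum // => i i_neq0; rewrite -mulr_algl.
  rewrite -mulrA -[t in _ / t]expr1 -expB ?lt0n //.
  by rewrite rpredM ?rpredX // powers_coord_O.
have -> : \sum_i coord powers i (amull z powers`_i) =
          \sum_i coord powers i ((z - a%:A) * t ^+ i).
  rewrite [RHS](eq_bigr (fun i => coord powers i (amull z powers`_i) - a)).
    by rewrite sumrB sumr_const card_ord -[a *+ n]mulr_natr n0 mulr0 subr0.
  move=> i _; rewrite lfunE /= powersE mulrBl raddfB /= mulr_algl linearZ /=.
  by rewrite -powersE coord_free ?eqxx ?mulr1 // (basis_free powers_basis).
rewrite scaler_suml mulr_suml rpred_sum // => i _.
set w := (z - a%:A) * t ^+ i.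
have wO : w / t ^+ i.+1 \in O.
  by rewrite /w exprSr invfM mulrA mulfK // expf_neq0.
have wO0 : w \in O by have := in_divX (leq0n _) wO; rewrite expr0 divr1.
apply: (@ram_coef_low (fun k => coord powers k w) i.+1) => //.
  by move=> k; apply: powers_coord_O.
by rewrite -powers_coord.
Qed.

End TotallyRamified.

(** * Places above a prime of F[x] *)

HB.instance Definition _ (F : finFieldType) (L : fieldExtType {fraction {poly F}}) :=
  GRing.RMorphism.copy (@poly_in F L) (in_alg L \o @FracField.tofrac {poly F}).

Section PlaceAbove.
Variables (F : finFieldType) (L : fieldExtType {fraction {poly F}}).
Variables (O : {pred L}) (P : {poly F}).
Local Notation K := {fraction {poly F}}.
Local Notation "p %:F" := (FracField.tofrac p).
Hypotheses (Pirr : irreducible_poly P) (Oval : valuation_ring O).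
Hypothesis OP : lies_above O P.

Let Oring : subring_closed O. Proof. by case: Oval. Qed.
HB.instance Definition _ := GRing.isSubringClosed.Build L O Oring.

Lemma poly_in_place (p : {poly F}) : poly_in L p \in O.
Proof.
apply/OP; exists p, 1; split; last by rewrite tofrac1 divr1.
by rewrite dvdp1 neq_ltn Pirr.1 orbT.
Qed.

Lemma integral_in_place z : integralOver (@poly_in F L) z -> z \in O.
Proof.
case: Oval => _ _ _ val [p pmon pz].
apply: (valuation_ring_integral Oring val) pz _.
  exact: monic_map.
by apply/polyOverP => i; rewrite coef_map poly_in_place.
Qed.

Lemma invP_notin_place : (poly_in L P)^-1 \notin O.
Proof.
have P0 := irredp_neq0 Pirr.
apply/negP; rewrite /poly_in -fmorphV => /OP[a [b [Pb]]].
have b0 : b != 0 by apply: contraNneq Pb => ->; rewrite dvdp0.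
move=> PE; have bE : b = a * P.
  apply/eqP; rewrite -tofrac_eq tofracM; apply/eqP.
  by rewrite -[a%:F](@divfK _ b%:F) -?PE ?tofrac_eq0 // mulrAC mulVf ?mul1r ?tofrac_eq0.
case/negP: Pb.
by rewrite bE dvdp_mull.
Qed.

Lemma unit_in_place (p : {poly F}) : ~~ (P %| p) -> (poly_in L p)^-1 \in O.
Proof.
by move=> Pp; rewrite /poly_in -fmorphV; apply/OP; exists 1, p; rewrite tofrac1 mul1r.
Qed.

(** [ramification_index O P n] with its uniformizer [t] made explicit. *)
Definition uniformizer n t := exists u : L,
    [/\ forall z, z \in max_ideal O <-> exists2 w, w \in O & z = t * w,
        u \in O, u^-1 \in O & poly_in L P = u * t ^+ n].

Section Uniformizer.
Variables (n : nat) (t : L).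
Hypotheses (n_gt0 : (0 < n)%N) (tP : uniformizer n t).

Lemma unif_neq0 : t != 0.
Proof.
apply: contraTneq (irredp_neq0 Pirr) => t0; case: tP => u [_ _ _].
rewrite t0 expr0n eqn0Ngt n_gt0 mulr0 => /eqP.
by rewrite /poly_in fmorph_eq0 tofrac_eq0 negbK.
Qed.

Lemma unif_max : t \in max_ideal O.
Proof. by case: tP => u [tm _ _ _]; apply/tm; exists 1; rewrite ?mulr1 ?rpred1. Qed.

Lemma unif_in : t \in O. Proof. by case/andP: unif_max. Qed.

Lemma unif_inv : t^-1 \notin O.
Proof. by case/andP: unif_max; rewrite (negPf unif_neq0). Qed.

Lemma unif_maxE z : (z \in max_ideal O) = (z / t \in O).
Proof.
case: tP => u [tm _ _ _]; apply/idP/idP => [/tm[w wO ->] | wO].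
  by rewrite mulrC mulKf ?unif_neq0.
by apply/tm; exists (z / t); rewrite // mulrC divfK ?unif_neq0.
Qed.

Lemma unif_dvd_max z : z \in O -> (z == 0) || (z^-1 \notin O) -> z / t \in O.
Proof. by move=> zO zV; rewrite -unif_maxE inE zO. Qed.

Lemma unif_base (r : K) : r%:A / t \in O ->
  exists a b : {poly F}, ~~ (P %| b) /\ r = P%:F * (a%:F / b%:F).
Proof.
rewrite -unif_maxE => /andP[/OP[a [b [Pb rE]]] rV].
have b0 : b != 0 by apply: contraNneq Pb => ->; rewrite dvdp0.
suff /dvdpP[a' aE] : P %| a.
  by exists a', b; split=> //; rewrite rE aE tofracM -mulrA mulrCA.
apply: contraLR rV => Pa; rewrite negb_or negbK scaler_eq0 oner_eq0 orbF.
have a0 : a != 0 by apply: contraNneq Pa => ->; rewrite dvdp0.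
rewrite rE mulf_neq0 ?invr_eq0 ?tofrac_eq0 //=.
have rVE (r' : K) : (r'%:A)^-1 = in_alg L r'^-1 by rewrite fmorphV.
by rewrite rVE invf_div; apply/OP; exists b, a.
Qed.

(** Membership in the maximal ideal gives a factor [P], hence a factor
    [t ^+ n]. *)
Lemma unif_base_dvdX (r : K) : r%:A / t \in O -> r%:A / t ^+ n \in O.
Proof.
case: tP => u [_ uO _ Pu] /unif_base[a [b [Pb ->]]].
have -> : (P%:F * (a%:F / b%:F))%:A = poly_in L P * in_alg L (a%:F / b%:F).
  by rewrite /poly_in -rmorphM.
rewrite Pu mulrAC mulfK ?expf_neq0 ?unif_neq0 // rpredM //.
by apply/OP; exists a, b.
Qed.

End Uniformizer.

Lemma uniformizer_mul_unit n t w : uniformizer n t ->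
  w != 0 -> w \in O -> w^-1 \in O -> uniformizer n (t * w).
Proof.
case=> u [tm uO uVO Pu] w0 wO wVO; exists (u * w^-1 ^+ n); split.
- move=> z; rewrite tm; split=> -[v vO ->].
    by exists (w^-1 * v); rewrite ?rpredM // mulrA mulfK.
  by exists (w * v); rewrite ?rpredM // mulrA.
- by rewrite rpredM ?rpredX.
- by rewrite invfM exprVn invrK rpredM ?rpredX.
by rewrite Pu exprMn exprVn mulrACA mulVf ?mulr1 ?expf_neq0.
Qed.

Let det_in_place n (M : 'M[K]_n) : (forall i j, (M i j)%:A \in O) -> (\det M)%:A \in O.
Proof.
have inA (r : K) : r%:A = in_alg L r by [].
move=> MO; rewrite inA /determinant rmorph_sum rpred_sum // => s _.
by rewrite rmorphMsign rpredMsign rmorph_prod rpred_prod // => i _; apply: MO.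
Qed.

Section DimensionN.
Variables (n : nat) (t : L).
Hypotheses (dimL : \dim {:L} = n) (tP : uniformizer n t).

Let n_gt0 : (0 < n)%N.
Proof. by rewrite -dimL adim_gt0. Qed.

Let val z : z != 0 -> (z \in O) || (z^-1 \in O).
Proof. by case: Oval => _ _ _; apply. Qed.

(** All entries of the Gram matrix are divisible by [P] locally, since they
    are traces of integral elements. *)
Lemma wild_disc (b : n.-tuple L) : n%:R = 0 :> F ->
  (forall i, integralOver (@poly_in F L) (tnth b i)) ->
  exists a d : {poly F}, ~~ (P %| d) /\ disc b = (P ^+ n)%:F * (a%:F / d%:F).
Proof.
move=> n0 b_int.
have nK : n%:R = 0 :> K.
  by rewrite -tofrac1 -tofracMn -[1 *+ n]polyC_natr n0 polyC0 tofrac0.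
have P0 : P%:F != 0 by rewrite tofrac_eq0 irredp_neq0.
pose M := \matrix_(i < n, j < n) ((P%:F)^-1 * field_trace (tnth b i * tnth b j)).
have MO i j : (M i j)%:A \in O.
  rewrite mxE; set z := tnth b i * _.
  have zO : z \in O by rewrite rpredM // integral_in_place.
  have := tot_ram_trace Oring val (unif_neq0 n_gt0 tP) (unif_in tP)
    (unif_inv n_gt0 tP) (unif_dvd_max n_gt0 tP) (unif_base_dvdX n_gt0 tP) dimL nK zO.
  move/(unif_base n_gt0 tP) => [a [d [Pd]]]; rewrite -/(field_trace z) => ->.
  by rewrite mulKf //; apply/OP; exists a, d.
have /OP[a [d [Pd MD]]] := det_in_place MO.
exists a, d; split => //; rewrite -MD tofracXn -detZ; congr (\det _).
by apply/matrixP => i j; rewrite !mxE mulVKf.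
Qed.

(** The powers of [t] are a local integral basis, so the matrix expressing [b]
    in them has entries, hence determinant, in [O]. *)
Lemma uniformizer_disc (b e : n.-tuple L) :
  (forall i, integralOver (@poly_in F L) (tnth b i)) ->
  (forall i, tnth e i = t ^+ i) ->
  exists r : K, r%:A \in O /\ disc b = r ^+ 2 * disc e.
Proof.
move=> b_int eE.
have c := powers_coord Oring val (unif_neq0 n_gt0 tP) (unif_in tP)
    (unif_inv n_gt0 tP) (unif_base_dvdX n_gt0 tP) dimL.
have cO := powers_coord_O Oring val (unif_neq0 n_gt0 tP) (unif_in tP)
    (unif_inv n_gt0 tP) (unif_dvd_max n_gt0 tP) (unif_base_dvdX n_gt0 tP) dimL.
pose M := \matrix_(i < n, j < n) coord (powers t n) j (tnth b i).
exists (\det M); split.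
  by apply: det_in_place => i j; rewrite mxE cO // integral_in_place.
apply: disc_change => i; rewrite [LHS]c.
by apply: eq_bigr => j _; rewrite mxE eE.
Qed.

End DimensionN.

End PlaceAbove.

(** * Power basis of a simple extension *)

Section SimpleExtension.
Variables (K : fieldType) (L : fieldExtType K) (p : {poly K}) (y : L).
Hypotheses (p_irr : irreducible_poly p) (py : root (map_poly (in_alg L) p) y).
Hypothesis gen_y : <<1; y>>%VS = {:L}%VS.

Lemma size_minPoly_irr : size (minPoly 1 y) = size p.
Proof.
have /polyOver1P[q qE] := minPolyOver 1 y.
have qp : q %| p.
  rewrite -(dvdp_map (in_alg L)) -qE minPoly_dvdp //.
  by apply/polyOver1P; exists p.
have sq : size q = size (minPoly 1 y) by rewrite qE size_map_poly.
rewrite -sq; apply/eqp_size/p_irr => //.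
by rewrite sq size_minPoly eqSS -lt0n /adjoin_degree.
Qed.

Lemma dim_simple_extension : \dim {:L} = (size p).-1.
Proof. by rewrite -gen_y dim_Fadjoin dimv1 muln1 -size_minPoly_irr size_minPoly. Qed.

Lemma powers_generator_basis : basis_of {:L} (powers y (size p).-1).
Proof.
rewrite basisEfree subvf size_tuple dim_simple_extension leqnn !andbT.
apply/freeP => c c0 i.
pose q := rVpoly (\row_j c j).
have cE j : c j = q`_j by rewrite coef_rVpoly_ord mxE.
have sq : (size q <= (size p).-1)%N by apply: size_poly.
suff q0 : map_poly (in_alg L) q == 0.
  by move: q0; rewrite cE map_poly_eq0 => /eqP ->; rewrite coef0.
rewrite -(@root_small_adjoin_poly _ _ 1%AS y).
- rewrite rootE (@horner_coef_wide _ (size p).-1) ?size_map_poly //.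
  apply/eqP; rewrite -[RHS]c0; apply: eq_bigr => j _.
  by rewrite powersE cE coef_map /= mulr_algl.
- by apply/polyOver1P; exists q.
by rewrite size_map_poly (leq_trans sq) // -size_minPoly_irr size_minPoly.
Qed.
End SimpleExtension.

(** * Divisibility of polynomials *)

Section PolyArith.
Variable F : finFieldType.
Implicit Types P A B C I : {poly F}.

Lemma exists_irreducible_factor A : (1 < size A)%N ->
  exists P, [/\ P \is monic, irreducible_poly P & P %| A].
Proof.
move=> sA; suff [P Pirr PA] : exists2 P, irreducible_poly P & P %| A.
  have lc : lead_coef P != 0 by rewrite lead_coef_eq0 irredp_neq0.
  have eqP' : (lead_coef P)^-1 *: P %= P by apply: eqp_scale; rewrite invr_eq0.
  exists ((lead_coef P)^-1 *: P); split.
  - by rewrite monicE lead_coefZ mulVf.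
  - split=> [|q sq qP]; first by rewrite (eqp_size eqP') Pirr.1.
    by rewrite (eqp_rtrans eqP') Pirr.2 // -(eqp_dvdr _ eqP').
  by rewrite (eqp_dvdl _ eqP').
have [n leAn] := ubnP (size A); elim: n => // n IHn in A sA leAn *.
have [/irreducibleP Airr | ] := boolP (irreducibleb A); first by exists A.
rewrite /irreducibleb sA negb_forall => /existsP[q].
rewrite negb_imply -Pdiv.Idomain.dvdpE -ltnNge => /andP[qA sq].
have [|P Pirr Pq] := IHn q sq.
  have := size_npoly q; rewrite -ltnS prednK ?(ltnW sA) // => /leq_trans; apply.
  by rewrite -ltnS.
by exists P => //; apply: dvdp_trans qA.
Qed.

Lemma irreducible_dvd_exp P A n : irreducible_poly P -> P %| A ^+ n -> P %| A.
Proof.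
move=> Pirr; apply: contraLR; rewrite -!irreducible_poly_coprime //.
exact: coprimep_expr.
Qed.

(** A squarefree polynomial is the product of its pairwise coprime primes;
    they are split off one at a time. *)
Lemma squarefree_exp_dvd k I C : I != 0 ->
  (forall P, P \is monic -> irreducible_poly P -> P %| I ->
     ~~ (P ^+ 2 %| I) /\ P ^+ k %| C) ->
  I ^+ k %| C.
Proof.
have [n leIn] := ubnP (size I); elim: n => // n IHn in I leIn *.
move=> I0 IP; have [sI | sI] := leqP (size I) 1.
  apply: (@dvdp_trans _ 1); last exact: dvd1p.
  rewrite dvdp1; move: sI; rewrite leq_eqVlt ltnS leqn0 size_poly_eq0 (negPf I0) orbF.
  by rewrite !size_poly_eq1 => /(eqp_exp k); rewrite expr1n.
have [P [Pmon Pirr PI]] := exists_irreducible_factor sI.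
have [P2I PkC] := IP P Pmon Pirr PI.
case/dvdpP: (PI) => /= J IE; move: I0; rewrite IE mulf_eq0 => /norP[J0 P0].
have PJ : ~~ (P %| J).
  by apply: contra P2I => PJ; rewrite IE expr2 dvdp_mul.
have sJ : (size J < size I)%N.
  rewrite IE size_mul // -[X in (X < _)%N]addn0 -subn1 -addnBA ?size_poly_gt0 //.
  by rewrite ltn_add2l subn_gt0 Pirr.1.
rewrite exprMn Gauss_dvdp ?PkC ?andbT.
  apply: IHn => // [|Q Qmon Qirr QJ]; first by rewrite (leq_trans sJ).
  have [|Q2 QC] := IP Q Qmon Qirr; first by rewrite IE dvdp_mulr.
  split=> //; apply: contra Q2 => /dvdp_trans; apply.
  by rewrite IE dvdp_mulr.
by rewrite coprimep_expl // coprimep_expr // coprimep_sym irreducible_poly_coprime.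
Qed.

Lemma dvd_exp_leq P A k m : irreducible_poly P -> ~~ (P %| A) ->
  P ^+ m %| (P ^+ k * A) ^+ 3 -> (m <= 3 * k)%N.
Proof.
move=> Pirr PA; rewrite exprMn -exprM mulnC; apply: contraLR; rewrite -ltnNge => lt.
apply: contra PA => /(dvdp_trans (dvdp_exp2l P lt)).
rewrite exprSr dvdp_mul2l ?expf_neq0 ?irredp_neq0 //.
exact: irreducible_dvd_exp.
Qed.

Lemma leq_poly_val P A n : (1 < size P)%N -> A != 0 -> P ^+ n %| A ->
  (n <= poly_val P A)%N.
Proof.
move=> sP A0 PA.
have nA : (n < size A)%N.
  apply: leq_trans (dvdp_leq A0 PA).
  have : P ^+ n != 0 by rewrite expf_neq0 // -size_poly_gt0 ltnW.
  rewrite -size_poly_gt0 => /prednK <-; rewrite size_exp ltnS leq_pmull //.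
  by rewrite -subn1 subn_gt0.
by rewrite /poly_val (bigmax_sup (Ordinal nA)).
Qed.

Lemma poly_val_dvd P A n : (n <= poly_val P A)%N -> P ^+ n %| A.
Proof.
rewrite /poly_val => nv.
apply: (@dvdp_trans _ (P ^+ (\max_(m < size A | P ^+ m %| A) m))).
  exact: dvdp_exp2l.
elim/big_ind: _ => [|i j Pi Pj|i //]; first by rewrite expr0 dvd1p.
by rewrite /maxn; case: ifP.
Qed.
End PolyArith.

(** * Integral bases *)

Section IntegralBases.
Variables (F : finFieldType) (L : fieldExtType {fraction {poly F}}).
Local Notation "p %:F" := (FracField.tofrac p).
Implicit Types (z : L).
Local Notation integral := (integralOver (@poly_in F L)).

Lemma poly_in_mul (p : {poly F}) z : poly_in L p * z = p%:F *: z.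
Proof. exact: mulr_algl. Qed.

Lemma integral_basis_coords n m (b : n.-tuple L) (e : m.-tuple L) :
    integral_basis b -> (forall i, integral (tnth e i)) ->
  exists M : 'M[{poly F}]_(m, n),
    forall i, tnth e i = \sum_j (map_mx (@FracField.tofrac _) M) i j *: tnth b j.
Proof.
case=> _ bP eint.
have /fin_all_exists[c cE] i : exists c : {ffun 'I_n -> {poly F}},
    tnth e i = \sum_j poly_in L (c j) * tnth b j.
  by case: (bP _ (eint i)) => c [cE _]; exists c.
exists (\matrix_(i, j) c i j) => i; rewrite cE; apply: eq_bigr => j _.
by rewrite !mxE poly_in_mul.
Qed.

Lemma basis_integral_basis n (b e : n.-tuple L) :
    integral_basis b -> (forall i, integral (tnth e i)) ->
  basis_of {:L} e -> basis_of {:L} b.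
Proof.
move=> bI eint ebas; have [M eE] := integral_basis_coords bI eint.
rewrite basisEdim size_tuple (size_basis ebas) leqnn andbT.
rewrite -(span_basis ebas); apply/span_subvP => _ /tnthP[i ->].
rewrite eE memv_suml // => j _; apply/memvZ/memv_span/mem_tnth.
Qed.

(** Traces of integral elements are polynomials, because multiplication by an
    integral element has a polynomial matrix in an integral basis. *)
Lemma integral_basis_disc n (b : n.-tuple L) :
  integral_basis b -> basis_of {:L} b -> exists d, disc b = d%:F.
Proof.
move=> bI bbas.
have trP z : integral z -> exists d, field_trace z = d%:F.
  (* The multiples z b_i are integral: their coordinates are the matrix of z. *)
  move=> zint; pose e := [tuple z * tnth b i | i < n].
  have eint i : integral (tnth e i).
    by rewrite tnth_mktuple; apply: integral_mul => //; apply: bI.1.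
  have [M eE] := integral_basis_coords bI eint.
  exists (\tr M); rewrite /field_trace (mxtrace_lfun_basis _ bbas).
  rewrite /mxtrace rmorph_sum; apply: eq_bigr => i _.
  rewrite lfunE /= -tnth_nth -[z * _](tnth_mktuple (fun i => z * tnth b i)) -/e eE.
  under eq_bigr do rewrite (tnth_nth 0).
  by rewrite coord_sum_free ?(basis_free bbas) // mxE.
have /fin_all_exists[d dE] (ij : 'I_n * 'I_n) :
    exists d, field_trace (tnth b ij.1 * tnth b ij.2) = d%:F.
  by apply/trP/integral_mul; apply: bI.1.
exists (\det (\matrix_(i, j) d (i, j))).
rewrite -det_map_mx; congr (\det _); apply/matrixP => i j.
by rewrite !mxE (dE (i, j)).
Qed.

(** The matrix expressing [e] in [b] is polynomial, and its determinant squares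
    to 1, so that its inverse is polynomial too. *)
Lemma integral_basis_same_disc n (b e : n.-tuple L) :
    integral_basis b -> (forall i, integral (tnth e i)) ->
  disc b != 0 -> disc e = disc b -> integral_basis e.
Proof.
move=> bI eint db0 de; have [M eE] := integral_basis_coords bI eint.
have Munit : M \in unitmx.
  rewrite unitmxE -(@unitrX_pos _ _ 2) //.
  suff -> : \det M ^+ 2 = 1 by rewrite unitr1.
  apply/eqP; rewrite -tofrac_eq tofrac1 tofracXn -det_map_mx.
  by apply/eqP/(mulIf db0); rewrite -(disc_change eE) de mul1r.
have comb (c : 'rV[{poly F}]_n) :
    \sum_i poly_in L (c 0 i) * tnth e i = \sum_j poly_in L ((c *m M) 0 j) * tnth b j.
  under eq_bigr do rewrite eE mulr_sumr.
  rewrite exchange_big; apply: eq_bigr => j _ /=.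
  rewrite mxE rmorph_sum mulr_suml; apply: eq_bigr => i _.
  by rewrite mxE rmorphM -mulrA; congr (_ * _); apply/esym/poly_in_mul.
split=> // z zint; have [c [zE cuniq]] := bI.2 z zint.
pose r := (\row_j c j) *m invmx M.
have rM : r *m M = \row_j c j by rewrite mulmxKV.
exists [ffun i => r 0 i]; split.
  under eq_bigr do rewrite ffunE.
  by rewrite comb rM zE; apply: eq_bigr => j _; rewrite mxE.
move=> c'; rewrite zE => c'E.
have := cuniq [ffun j => ((\row_i c' i) *m M) 0 j].
have -> : z = \sum_i poly_in L ([ffun j => ((\row_i c' i) *m M) 0 j] i) * tnth b i.
  rewrite zE c'E. under [RHS]eq_bigr do rewrite ffunE.
  by rewrite -comb; apply: eq_bigr => i _; rewrite mxE.
move/(_ erefl) => cE; apply/ffunP => i; rewrite ffunE /r.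
have -> : \row_j c j = (\row_i c' i) *m M by apply/rowP => j; rewrite mxE cE ffunE.
by rewrite mulmxK // mxE.
Qed.
End IntegralBases.

(** * Cubic fields in characteristic 3 *)

Lemma det_hankel3 (R : comNzRingType) (g : nat -> R) :
  \det (\matrix_(i < 3, j < 3) g (i + j)%N) =
    g 0 * g 2 * g 4 + 2%:R * (g 1 * g 2 * g 3) - g 0 * g 3 ^+ 2
      - g 1 ^+ 2 * g 4 - g 2 ^+ 3.
Proof.
rewrite (expand_det_row _ ord0) !big_ord_recl big_ord0 /cofactor.
rewrite !(expand_det_row _ ord0) !big_ord_recl !big_ord0 /cofactor !det_mx11 !mxE /=.
rewrite /bump /= ?addn0 ?add0n ?addnS ?addSn; ring.
Qed.

Section CubicField.
Variables (F : finFieldType) (L : fieldExtType {fraction {poly F}}).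
Variables (A B : {poly F}) (y : L).
Local Notation K := {fraction {poly F}}.
Local Notation "p %:F" := (FracField.tofrac p).
Local Notation integral := (integralOver (@poly_in F L)).
Hypotheses (charF : 3 \in [pchar F]) (std : cubic_standard_form A B y).

Lemma size_cubic_poly : size (cubic_poly A B) = 4.
Proof.
rewrite /cubic_poly -addrA size_polyDl ?size_polyXn //.
rewrite (leq_ltn_trans (size_polyD _ _)) // gtn_max size_polyN.
rewrite (leq_ltn_trans (size_scale_leq _ _)) ?size_polyX //=.
by rewrite (leq_ltn_trans (size_polyC_leq1 _)).
Qed.

Lemma cubic_dim : \dim {:L} = 3.
Proof.
have := dim_simple_extension (csf_irreducible std) (csf_root std).
by move=> /(_ (csf_generated std)) ->; rewrite size_cubic_poly.
Qed.

Lemma tnth_powers3 (z : L) i : tnth [tuple 1; z; z ^+ 2] i = z ^+ i.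
Proof. by case: i => [[|[|[|i]]]] //= lt; rewrite (tnth_nth 0). Qed.

Lemma powers3 (z : L) : [tuple 1; z; z ^+ 2] = powers z 3.
Proof. by apply: eq_from_tnth => i; rewrite tnth_powers3 tnth_mktuple. Qed.

Lemma cubic_basis : basis_of {:L} [tuple 1; y; y ^+ 2].
Proof.
have := powers_generator_basis (csf_irreducible std) (csf_root std).
by move=> /(_ (csf_generated std)); rewrite size_cubic_poly powers3.
Qed.

Lemma cubic_eq : y ^+ 3 = A%:F *: y - B%:F *: 1.
Proof.
have := rootP (csf_root std); rewrite /cubic_poly.
rewrite rmorphD rmorphB /= map_polyXn map_polyZ map_polyX map_polyC /=.
rewrite !hornerE /= mulr_algl => /eqP; rewrite -addrA addr_eq0 => /eqP ->.
by rewrite opprD opprK.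
Qed.

Lemma three0 (R : nzRingType) (f : {rmorphism F -> R}) : 3%:R = 0 :> R.
Proof. by rewrite -(rmorph_nat f) (pcharf0 charF) rmorph0. Qed.

Lemma three0K : 3%:R = 0 :> K.
Proof. exact: (three0 (@FracField.tofrac _ \o polyC)). Qed.

Lemma three0L : 3%:R = 0 :> L.
Proof. exact: (three0 (in_alg L \o (@FracField.tofrac _ \o polyC))). Qed.

Lemma cubic_trace z (a : nat -> nat -> K) :
  (forall i, (i < 3)%N -> z * y ^+ i = a i 0%N *: 1 + a i 1%N *: y + a i 2%N *: y ^+ 2) ->
  field_trace z = a 0%N 0%N + a 1%N 1%N + a 2%N 2%N.
Proof.
move=> az; rewrite /field_trace (mxtrace_lfun_basis _ cubic_basis).
transitivity (\sum_(i < 3) a i i).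
  apply: eq_bigr => i _; rewrite lfunE /= -tnth_nth tnth_powers3 az //.
  rewrite -[RHS](coord_sum_free (fun j : 'I_3 => a i j) i (basis_free cubic_basis)).
  by rewrite !big_ord_recr big_ord0 /= add0r.
by rewrite !big_ord_recr big_ord0 /= add0r.
Qed.

Lemma trace_y0 : field_trace (y ^+ 0) = 0.
Proof.
rewrite (@cubic_trace _ (fun i j => (i == j)%:R)).
  by rewrite /= -[RHS]three0K; ring.
case=> [|[|[|i]]] //= _; rewrite !scale1r !scale0r; ring.
Qed.

Lemma trace_y1 : field_trace (y ^+ 1) = 0.
Proof.
pose rows := [:: [:: 0; 1]; [:: 0; 0; 1]; [:: - B%:F; A%:F]].
rewrite (@cubic_trace _ (fun i j => nth 0 (nth [::] rows i) j)).
  by rewrite /=; ring.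
case=> [|[|[|i]]] //= _; rewrite -exprD ?cubic_eq !scale0r ?scale1r ?add0r ?addr0 //.
by rewrite scaleNr addrC.
Qed.

Lemma trace_y2 : field_trace (y ^+ 2) = 2%:R * A%:F.
Proof.
pose rows := [:: [:: 0; 0; 1]; [:: - B%:F; A%:F]; [:: 0; - B%:F; A%:F]].
rewrite (@cubic_trace _ (fun i j => nth 0 (nth [::] rows i) j)).
  by rewrite /=; ring.
case=> [|[|[|i]]] //= _; rewrite -exprD ?(exprS _ 3) ?cubic_eq !scale0r;
  rewrite ?scale1r ?add0r ?addr0 //.
  by rewrite scaleNr addrC.
by rewrite mulrBr -!scalerAr -expr2 mulr1 scaleNr addrC.
Qed.

Lemma trace_y3 : field_trace (y ^+ 3) = 0.
Proof.
rewrite cubic_eq linearB !linearZ /= -[y in field_trace y]expr1 -(expr0 y).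
by rewrite trace_y0 trace_y1 !mulr0 subr0.
Qed.

Lemma trace_y4 : field_trace (y ^+ 4) = 2%:R * A%:F ^+ 2.
Proof.
rewrite exprS cubic_eq mulrBr -!scalerAr mulr1 -expr2 linearB !linearZ /=.
by rewrite -[y in _ - _ * field_trace y]expr1 trace_y1 trace_y2; ring.
Qed.

Lemma cubic_disc : disc [tuple 1; y; y ^+ 2] = (A ^+ 3)%:F.
Proof.
rewrite /disc.
set G := (G in \det G).
have -> : G = \matrix_(i < 3, j < 3) field_trace (y ^+ (i + j)).
  by apply/matrixP => i j; rewrite !mxE !tnth_powers3 exprD.
rewrite (det_hankel3 (fun k => field_trace (y ^+ k))).
rewrite trace_y0 trace_y1 trace_y2 trace_y3 trace_y4 tofracXn.
(* The Hankel determinant is - (2 A)^3 = - 8 A^3. *)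
transitivity (A%:F ^+ 3 - 3%:R * (3%:R * A%:F ^+ 3)); first by ring.
by rewrite three0K mul0r subr0.
Qed.

Lemma cubic_eq_poly : y ^+ 3 = poly_in L A * y - poly_in L B.
Proof. by rewrite cubic_eq /poly_in /= mulr_algl. Qed.

Lemma y_integral : integral y.
Proof.
exists ('X^3 - A *: 'X + B%:P).
  rewrite monicE lead_coefDl ?lead_coefDl ?lead_coefXn //.
    rewrite size_polyN size_polyXn (leq_ltn_trans (size_scale_leq _ _)) //.
    by rewrite size_polyX.
  rewrite size_polyDl ?size_polyXn ?size_polyN; last first.
    by rewrite (leq_ltn_trans (size_scale_leq _ _)) // size_polyX.
  by rewrite (leq_ltn_trans (size_polyC_leq1 _)).
rewrite rootE rmorphD rmorphB /= map_polyXn map_polyZ map_polyX map_polyC /=.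
rewrite !hornerE /= cubic_eq_poly; apply/eqP; ring.
Qed.

(** Put [t = y - U], which satisfies [t^3 = A t - C] for [C = U^3 + B - A U].
    With [A = A' I] and [C^2 = C' I^3], the quotient [w = t^2 / I] is a root of
    [X^3 + A' X^2 + A'^2 X - C']. *)
Lemma square_quotient_integral (I U : {poly F}) :
    I != 0 -> I %| A -> I ^+ 3 %| (U ^+ 3 + B - A * U) ^+ 2 ->
  integral ((y - poly_in L U) ^+ 2 / poly_in L I).
Proof.
move=> I0 /dvdpP[A' AE] /dvdpP[C' CE].
have i0 : poly_in L I != 0 by rewrite /poly_in fmorph_eq0 tofrac_eq0.
have : (y - poly_in L U) ^+ 2 / poly_in L I * poly_in L I = (y - poly_in L U) ^+ 2.
  by rewrite divfK.
move: (_ / _) => w wE.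
pose q := A' *: 'X^2 + (A' ^+ 2 *: 'X - C'%:P).
have sq : (size q < 4)%N.
  rewrite (leq_ltn_trans (size_polyD _ _)) // gtn_max.
  rewrite (leq_ltn_trans (size_scale_leq _ _)) ?size_polyXn //.
  rewrite (leq_ltn_trans (size_polyD _ _)) // gtn_max size_polyN.
  rewrite (leq_ltn_trans (size_scale_leq _ _)) ?size_polyX //.
  by rewrite (leq_ltn_trans (size_polyC_leq1 _)).
exists ('X^3 + q).
  by rewrite monicE lead_coefDl ?lead_coefXn // size_polyXn.
rewrite rootE /q !rmorphD rmorphN /= !map_polyZ !map_polyXn map_polyX map_polyC /=.
rewrite !hornerE /=; apply/eqP; apply: (mulIf (expf_neq0 3 i0)); rewrite mul0r.
have y3 := cubic_eq_poly.
have := congr1 (@poly_in F L) CE; have := congr1 (@poly_in F L) AE.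
rewrite !(rmorphXn, rmorphM, rmorphB, rmorphD) /=.
move: y3 i0 wE; rewrite /=.
set i := poly_in L I; set u := poly_in L U; set a := poly_in L A.
set a' := poly_in L A'; set c' := poly_in L C'; set b := poly_in L B.
move=> y3 i0 wE aE cE.
have tE : (y - u) ^+ 3 = a * (y - u) - (u ^+ 3 + b - a * u).
  (* The cube of a difference is the difference of the cubes up to 3. *)
  transitivity (y ^+ 3 - u ^+ 3 + 3%:R * (y * u ^+ 2 - y ^+ 2 * u)); first by ring.
  by rewrite three0L y3; ring.
transitivity ((w * i) ^+ 3 + a' * i * (w * i) ^+ 2 + (a' * i) ^+ 2 * (w * i) - c' * i ^+ 3).
  by ring.
rewrite -cE -aE wE; move: tE; set t := y - u; set c := _ + b - _ => tE.
transitivity ((t ^+ 3) ^+ 2 + a * t * t ^+ 3 + a ^+ 2 * t ^+ 2 - c ^+ 2); first by ring.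
rewrite tE; transitivity (3%:R * (a ^+ 2 * t ^+ 2 - a * t * c)); first by ring.
by rewrite three0L mul0r.
Qed.
End CubicField.

(** * The index at a prime *)

Section Eisenstein.
Variables (F : finFieldType) (L : fieldExtType {fraction {poly F}}).
Variables (A B : {poly F}) (y : L).
Local Notation "p %:F" := (FracField.tofrac p).
Local Notation integral := (integralOver (@poly_in F L)).
Hypotheses (charF : 3 \in [pchar F]) (std : cubic_standard_form A B y).
Variables (O : {pred L}) (P : {poly F}).
Hypotheses (Pirr : irreducible_poly P) (Oval : valuation_ring O) (OP : lies_above O P).
Let Oring : subring_closed O. Proof. by case: Oval. Qed.
HB.instance Definition _ := GRing.isSubringClosed.Build L O Oring.

(** From [y^3 = A y - B], the valuation of [y] is positive, so [A y] has
    valuation at least 4 whereas [B] has valuation exactly 3.  Hence [y^3] has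
    valuation 3. *)
Lemma eisenstein_uniformizer t : uniformizer O P 3 t ->
  P %| A -> P %| B -> ~~ (P ^+ 2 %| B) -> uniformizer O P 3 y.
Proof.
have n3 : (0 < 3)%N by [].
move=> tP /dvdpP[A' AE] /dvdpP[B' BE] P2B.
have PB' : ~~ (P %| B').
  by apply: contra P2B => PB'; rewrite BE expr2 dvdp_mul.
have t0 : t != 0 by apply: unif_neq0 tP.
have tO := unif_in Oval tP; have tV := unif_inv Pirr Oval n3 tP.
have yO : y \in O by apply: (integral_in_place Pirr Oval OP); apply: y_integral std.
have pO := poly_in_place Pirr OP.
case: (tP) => u [tm uO uVO Pu].
have u0 : u != 0.
  apply: contraTneq (irredp_neq0 Pirr) => u0; move/eqP: Pu.
  by rewrite u0 mul0r /poly_in fmorph_eq0 tofrac_eq0 negbK.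
set v := poly_in L A' * y - poly_in L B'.
have y3 : y ^+ 3 = t ^+ 3 * (u * v).
  rewrite (cubic_eq_poly std) AE BE !rmorphM /= Pu /v; ring.
have vO : v \in O by rewrite rpredB ?rpredM ?pO.
have yt : y / t \in O.
  apply: (unif_dvd_max Pirr n3 tP yO).
  have [//|y0 /=] := eqVneq y 0; apply: contra tV => yVO.
  (* If y were a unit, then y^3 = t^3 u v would make t one. *)
  have -> : t^-1 = t ^+ 2 * (u * v) * y^-1 ^+ 3.
    rewrite exprVn; apply: (mulIf (expf_neq0 3 y0)).
    by rewrite mulfVK ?expf_neq0 // y3; field.
  by rewrite !rpredM ?rpredX.
have [v0 vV] : v != 0 /\ v^-1 \in O.
  have : v \notin max_ideal O.
    rewrite (unif_maxE Pirr n3 tP); apply/negP.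
    rewrite /v mulrBl -mulrA rpredBl; last by rewrite rpredM ?pO.
    rewrite -(unif_maxE Pirr n3 tP) !inE /= (unit_in_place OP) // orbF.
    by rewrite pO /poly_in fmorph_eq0 tofrac_eq0 => /eqP B0; rewrite B0 dvdp0 in PB'.
  by rewrite !inE vO /= negb_or negbK => /andP.
set w := y / t in yt.
have w3 : w ^+ 3 = u * v by rewrite /w expr_div_n y3 mulrC mulKf ?expf_neq0.
have w0 : w != 0 by have := mulf_neq0 u0 v0; rewrite -w3 expf_eq0.
rewrite -[y](divfK t0) mulrC -/w.
apply: (uniformizer_mul_unit Oval tP) => //.
have -> : w^-1 = w ^+ 2 * (u^-1 * v^-1).
  by rewrite -invfM -w3; field.
by rewrite rpredM ?rpredX // rpredM.
Qed.

(** If [b] is an integral basis then [disc b = r^2 disc(1, y, y^2)] with [r] in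
    [O], while [disc(1, y, y^2) = I^2 disc b].  So [(r I)^2 = 1], and [I] is a
    unit of [O]. *)
Lemma uniformizer_index (I : {poly F}) : A != 0 -> uniformizer O P 3 y ->
  is_index y I -> ~~ (P %| I).
Proof.
move=> A0 yP [b [bI]] DE; apply/negP => /dvdpP[I' IE].
have [r [rO bE]] := uniformizer_disc Pirr Oval OP (cubic_dim std) yP bI.1 (tnth_powers3 y).
have r2 : (r * I%:F) ^+ 2 = 1.
  have D0 : disc [tuple 1; y; y ^+ 2] != 0.
    by rewrite (cubic_disc charF std) tofrac_eq0 expf_neq0.
  by apply: (mulIf D0); rewrite mul1r {2}DE bE exprMn; ring.
case/negP: (invP_notin_place Pirr OP).
have P0 : P%:F != 0 by rewrite tofrac_eq0 irredp_neq0.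
have -> : (poly_in L P)^-1 = r%:A ^+ 2 * poly_in L (I' ^+ 2 * P).
  have -> : r%:A ^+ 2 * poly_in L (I' ^+ 2 * P) =
      in_alg L (r ^+ 2 * (I' ^+ 2 * P)%:F).
    by rewrite [RHS]rmorphM [in RHS]rmorphXn.
  rewrite /poly_in -fmorphV; congr (in_alg L _).
  by apply: (mulfI P0); rewrite mulfV // -r2 IE !tofracM; ring.
by rewrite rpredM ?rpredX // (poly_in_place Pirr OP).
Qed.

End Eisenstein.

Section IndexAtAPrime.
Variables (F : finFieldType) (L : fieldExtType {fraction {poly F}}).
Variables (A B : {poly F}) (y : L).
Local Notation "p %:F" := (FracField.tofrac p).
Local Notation integral := (integralOver (@poly_in F L)).
Hypotheses (charF : 3 \in [pchar F]) (std : cubic_standard_form A B y).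
Hypotheses (A_neq0 : A != 0) (A_cubefree : cubefree A).
Hypothesis sig31 : forall P : {poly F}, P \is monic -> irreducible_poly P ->
       (2 * poly_val P B < 3 * poly_val P A)%N -> signature1 L P 3 1.
Variable (I : {poly F}).
Hypothesis ind_I : is_index y I.

Lemma sig31_wild_disc P (b : 3.-tuple L) d : irreducible_poly P ->
  (forall i, integral (tnth b i)) -> disc b = d%:F -> signature1 L P 3 1 -> P ^+ 3 %| d.
Proof.
move=> Pirr bint bd [O [Oval OP _ [t tP] _]].
have [a [c [Pc]]] := wild_disc Pirr Oval OP (cubic_dim std) tP (pcharf0 charF) bint.
rewrite bd => dE.
have c0 : c != 0 by apply: contraNneq Pc => ->; rewrite dvdp0.
have E : d * c = P ^+ 3 * a.
  apply/eqP; rewrite -tofrac_eq [X in X == _]tofracM [X in _ == X]tofracM dE.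
  by rewrite -mulrA divfK // tofrac_eq0.
have cop : coprimep (P ^+ 3) c by rewrite coprimep_expl // irreducible_poly_coprime.
by rewrite -(Gauss_dvdpl _ cop) E dvdp_mulr.
Qed.

(** Write [a, b, i] for the valuations of [A, B, I] at [P], and use
    [A^3 = I^2 d].  If [a = 2] the standard form gives [b <= 2], so the place
    has signature [(3, 1)], [P^3] divides [d], and [2 i + 3 <= 6]; the value
    [b = 1] is the Eisenstein case, where [i = 0].  If [a = 1] then [2 i <= 3];
    signature [(3, 1)] would give [2 i + 3 <= 3], so [2 b >= 3]. *)
Lemma index_local (P : {poly F}) : P \is monic -> irreducible_poly P -> P %| I ->
  [/\ P %| A, ~~ (P ^+ 2 %| I)
    & (P %| B -> P ^+ 2 %| B) /\ (~~ (P %| B) -> P ^+ 2 %| A)].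
Proof.
move=> Pmon Pirr PI.
have sP := Pirr.1.
have [b [bI DE]] := ind_I.
have e0int i : integral (tnth [tuple 1; y; y ^+ 2] i).
  rewrite tnth_powers3; case: (nat_of_ord i) => [|n]; first exact: integral1.
  elim: n => [|n IHn]; first exact: y_integral std.
  by rewrite exprS; apply: integral_mul => //; apply: y_integral std.
have [d dE] := integral_basis_disc bI (basis_integral_basis bI e0int (cubic_basis std)).
have AE : A ^+ 3 = I ^+ 2 * d.
  apply/eqP; rewrite -tofrac_eq -(cubic_disc charF std) DE dE tofracM tofracXn.
  by [].
have wild : signature1 L P 3 1 -> P ^+ 3 %| d.
  exact: sig31_wild_disc Pirr bI.1 dE.
have PA : P %| A.
  by apply: (irreducible_dvd_exp (n := 3) Pirr); rewrite AE expr2 -mulrA dvdp_mulr.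
have leqA k : P ^+ k %| A -> (k <= poly_val P A)%N by apply: leq_poly_val.
have [P2A | P2A] := boolP (P ^+ 2 %| A).
  have P3B : ~~ (P ^+ 3 %| B).
    by apply/negP => /(csf_reduced std P2A); rewrite leqNgt sP.
  have sig : signature1 L P 3 1.
    apply: sig31 => //; apply: (@leq_trans (3 * 2)); last by rewrite leq_mul2l leqA.
    rewrite (leq_ltn_trans (n := 2 * 2)) // leq_mul2l /= leqNgt.
    by apply: contra P3B => /poly_val_dvd.
  case/dvdpP: (P2A) => A1; rewrite mulrC => A1E.
  have PA1 : ~~ (P %| A1).
    apply/negP => PA1; suff /A_cubefree : P ^+ 3 %| A by rewrite leqNgt sP.
    by rewrite A1E exprSr dvdp_mul2l ?expf_neq0 ?irredp_neq0.
  split=> //.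
    apply/negP => P2I.
    (* P^4 divides I^2 and P^3 divides d, but A^3 has valuation 6. *)
    suff /(dvd_exp_leq Pirr PA1) : P ^+ 7 %| (P ^+ 2 * A1) ^+ 3 by [].
    by rewrite -A1E AE (exprD P 4 3) dvdp_mul ?wild // (exprM P 2 2) dvdp_exp2r.
  split=> // PB; apply/negPn/negP => P2B.
  have [O [Oval OP _ [t tP] _]] := sig.
  have yP := eisenstein_uniformizer std Pirr Oval OP tP PA PB P2B.
  by have := uniformizer_index charF std Pirr Oval OP A_neq0 yP ind_I; rewrite PI.
case/dvdpP: (PA) => A1; rewrite mulrC -{1}[P]expr1 => A1E.
have PA1 : ~~ (P %| A1).
  by apply: contra P2A => PA1; rewrite A1E expr2 expr1 dvdp_mul.
have nosig : ~ signature1 L P 3 1.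
  move=> sig.
  (* P^2 divides I^2 and P^3 divides d, but A^3 has valuation 3. *)
  suff /(dvd_exp_leq Pirr PA1) : P ^+ 5 %| (P ^+ 1 * A1) ^+ 3 by [].
  by rewrite -A1E AE (exprD P 2 3) dvdp_mul ?wild // dvdp_exp2r.
have P2B : P ^+ 2 %| B.
  apply: poly_val_dvd; rewrite leqNgt; apply/negP => lt2; apply: nosig.
  apply: sig31 => //; apply: (@leq_trans (3 * 1)); last by rewrite leq_mul2l leqA.
  by rewrite (leq_ltn_trans (n := 2 * 1)) // leq_mul2l.
split=> //.
  apply/negP => P2I.
  suff /(dvd_exp_leq Pirr PA1) : P ^+ 4 %| (P ^+ 1 * A1) ^+ 3 by [].
  by rewrite -A1E AE dvdp_mulr // (exprM P 2 2) dvdp_exp2r.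
split=> // /negP[]; apply: dvdp_trans P2B; exact: dvdp_mulr.
Qed.
End IndexAtAPrime.

(** At a prime [P] dividing [I]: if [P] divides [B] then it divides [gcd(I, B)],
    hence [U], and each of [U^3], [B], [A U] is divisible by [P^2].
    Otherwise [P] divides [I / gcd(I, B)] and [P^2] divides both [U^3 + B] and
    [A]. *)
Lemma dvd_shifted_cubic (F : finFieldType) (A B I U : {poly F}) : I != 0 ->
  (forall P, P \is monic -> irreducible_poly P -> P %| I ->
    [/\ P %| A, ~~ (P ^+ 2 %| I)
      & (P %| B -> P ^+ 2 %| B) /\ (~~ (P %| B) -> P ^+ 2 %| A)]) ->
  (I %/ gcdp I B) ^+ 2 %| U ^+ 3 + B -> gcdp I B %| U ->
  I ^+ 2 %| U ^+ 3 + B - A * U.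
Proof.
move=> I0 Iloc hU3 hU; apply: squarefree_exp_dvd => // P Pmon Pirr PI.
have [PA P2I [PB2 PnB]] := Iloc P Pmon Pirr PI; split=> //.
have [PB | PB] := boolP (P %| B).
  have PU : P %| U by apply: dvdp_trans hU; rewrite dvdp_gcd PI.
  rewrite dvdp_sub ?dvdp_add ?PB2 //; last by rewrite expr2 dvdp_mul.
  exact: dvdp_trans (dvdp_exp2l P (isT : (2 <= 3)%N)) (dvdp_exp2r 3 PU).
rewrite dvdp_sub //; last by rewrite dvdp_mulr ?PnB.
apply: dvdp_trans hU3; apply: dvdp_exp2r.
move: PI; rewrite -{1}(divpK (dvdp_gcdl I B)) Gauss_dvdpl //.
by rewrite irreducible_poly_coprime // dvdp_gcd (negPf PB) andbF.
Qed.

Theorem theorem2p3p7 (F : finFieldType) (charF : 3 \in [pchar F])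
    (L : fieldExtType {fraction {poly F}}) (A B : {poly F}) (y : L)
    (std : cubic_standard_form A B y)
    (A_neq0 : A != 0) (A_cubefree : cubefree A)
    (sig31 : forall P : {poly F}, P \is monic -> irreducible_poly P ->
       (2 * poly_val P B < 3 * poly_val P A)%N -> signature1 L P 3 1)
    (I : {poly F}) (ind_I : is_index y I) (U V W : {poly F})
    (hU3 : (I %/ gcdp I B) ^+ 2 %| U ^+ 3 + B)
    (hU : gcdp I B %| U)
    (hV : I %| V - U ^+ 2) :
  integral_basis
    [tuple 1; y + poly_in L W;
       (y ^+ 2 + poly_in L U * y + poly_in L V) / poly_in L I].
Proof.
have [b [bI DE]] := ind_I.
have D0 : disc [tuple 1; y; y ^+ 2] != 0.
  by rewrite (cubic_disc charF std) tofrac_eq0 expf_neq0.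
have iK0 : FracField.tofrac I != 0.
  by apply: contraNneq D0 => I0; rewrite DE I0 expr0n mul0r.
have db0 : disc b != 0.
  by apply: contraNneq D0 => b0; rewrite DE b0 mulr0.
have I0 : I != 0 by rewrite -tofrac_eq0.
have i0 : poly_in L I != 0 by rewrite /poly_in fmorph_eq0; exact: iK0.
have Iloc P := @index_local F L A B y charF std A_neq0 A_cubefree sig31 I ind_I P.
have IA : I %| A.
  rewrite -[I]expr1; apply: squarefree_exp_dvd => // P Pmon Pirr PI.
  by have [PA P2I _] := Iloc P Pmon Pirr PI.
have IC := dvd_shifted_cubic I0 Iloc hU3 hU.
have I3C : I ^+ 3 %| (U ^+ 3 + B - A * U) ^+ 2.
  apply: dvdp_trans (dvdp_exp2r 2 IC); rewrite -exprM; exact: dvdp_exp2l.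
have yint := y_integral std.
case/dvdpP: hV => k VE.
have wE : (y ^+ 2 + poly_in L U * y + poly_in L V) / poly_in L I =
   (y - poly_in L U) ^+ 2 / poly_in L I + poly_in L k.
  apply: (mulIf i0); rewrite [RHS]mulrDl !divfK // -rmorphM -VE rmorphB rmorphXn /=.
  (* In characteristic 3, (y - U)^2 = y^2 + U y + U^2: the difference is 3 U y. *)
  rewrite -[LHS]subr0 -[X in _ - X](mul0r (poly_in L U * y)) -(three0L L charF).
  by ring.
apply: (integral_basis_same_disc bI) => //.
  case=> [[|[|[|i]]]] //= lt; rewrite (tnth_nth 0) /=.
  - exact: integral1.
  - by apply: integral_add => //; apply: integral_id.
  rewrite wE; apply: integral_add; last exact: integral_id.
  exact: (square_quotient_integral charF std I0 IA I3C).
pose rows := [:: [:: 1]; [:: FracField.tofrac W; 1];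
  [:: FracField.tofrac V / FracField.tofrac I; FracField.tofrac U / FracField.tofrac I;
      (FracField.tofrac I)^-1]].
pose M := \matrix_(i < 3, j < 3) nth 0 (nth [::] rows i) j.
rewrite (@disc_change F L 3 M [tuple 1; y; y ^+ 2]); last first.
  move=> i; under eq_bigr do rewrite mxE tnth_powers3.
  rewrite !big_ord_recr big_ord0 /= add0r.
  case: i => [[|[|[|i]]]] //= lt; rewrite (tnth_nth 0) /= ?scale0r ?addr0 ?scale1r //.
    by rewrite [RHS]addrC.
  have scaleE (p q : {poly F}) (z : L) :
      (FracField.tofrac p / FracField.tofrac q) *: z = poly_in L p / poly_in L q * z.
    by rewrite /poly_in -fmorph_div mulr_algl.
  by rewrite !scaleE -[(FracField.tofrac I)^-1]mul1r -tofrac1 scaleE rmorph1; field.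
have -> : \det M = (FracField.tofrac I)^-1.
  rewrite det_trig; last first.
    apply/is_trig_mxP => i j; rewrite mxE.
    by case: i j => [[|[|[|i]]]] //= ? [[|[|[|j]]]].
  by rewrite !big_ord_recr big_ord0 /= !mxE /= !mul1r.
rewrite DE mulrA -exprMn (mulVf iK0) expr1n.
exact: mul1r.
Qed.
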